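(* Let $n\ge1$ be an integer and let $\mathcal{U}$ be a right Lebesgue-ultrafilter on $\mathbb{R}$. Then the functional $\mathcal{B}\lim_{\mathcal{U}}:L^\infty(\mathbb{R}^n)\to\mathbb{R}$, $u\mapsto\lim_{\mathcal{U}}\widehat{u}$, is linear, order-preserving, continuous and translation-invariant (that is, it takes the same value on $u$ and $\mathcal{T}_tu$ for all $u\in L^\infty(\mathbb{R}^n)$ and $t\in\mathbb{R}^n$).
   Context: $L^\infty(\mathbb{R}^n)$ is the usual space of essentially bounded Lebesgue measurable functions $\mathbb{R}^n\to\mathbb{R}$ modulo almost everywhere equality, with the essential supremum norm; continuity is with respect to this norm. $\mathcal{T}_tu(x):=u(x-t)$. Order-preserving means that $u\le v$ almost everywhere implies that the value at $u$ is at most the value at $v$. For a bounded measurable $u:\mathbb{R}^n\to\mathbb{R}$ its Cesàro-like average is the function $\widehat{u}:\mathbb{R}\to\mathbb{R}$ given by $\widehat{u}(x):=\frac{1}{|B_x(0)|}\int_{B_x(0)}u(y)\,dy$ for $x>0$ and $\widehat{u}(x):=0$ for $x\le0$, where $B_x(0)$ is the ball in $\mathbb{R}^n$ of radius $x$ centred at $0$ and $|\cdot|$ is $n$-dimensional Lebesgue measure; this induces an operator $\widehat{\cdot}:L^\infty(\mathbb{R}^n)\to L^\infty(\mathbb{R})$. A filter on $\mathbb{R}$ is a family $\mathcal{F}$ of subsets of $\mathbb{R}$ with $\mathbb{R}\in\mathcal{F}$, $\emptyset\notin\mathcal{F}$, closed under finite intersections and under supersets in $\mathbb{R}$. An ultrafilter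 is a filter $\mathcal{U}$ such that for all $A\subseteq\mathbb{R}$ either $A\in\mathcal{U}$ or $\mathbb{R}\setminus A\in\mathcal{U}$. A right Lebesgue-ultrafilter is an ultrafilter $\mathcal{U}$ such that $\mathbb{R}\setminus N\in\mathcal{U}$ for every Lebesgue-null set $N\subseteq\mathbb{R}$ and $(a,\infty)\in\mathcal{U}$ for all $a\in\mathbb{R}$. For such $\mathcal{U}$ and $v\in L^\infty(\mathbb{R})$, $\lim_{\mathcal{U}}v$ is the (unique, representative-independent) real number $l$ such that $\{x\in\mathbb{R}:|v(x)-l|<\varepsilon\}\in\mathcal{U}$ for all $\varepsilon>0$. *)

(* Defs.v *)
From HB Require Import structures.
From mathcomp Require Import all_boot all_order all_algebra.
From mathcomp Require Import all_classical all_reals all_analysis.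
From mathcomp Require Import ess_sup_inf measurable_realfun.
From mathcomp Require Import lra.
Set Implicit Arguments.
Unset Strict Implicit.
Unset Printing Implicit Defensive.
Import Order.TTheory GRing.Theory Num.Theory.
Import numFieldNormedType.Exports.
Local Open Scope classical_set_scope.
Local Open Scope ring_scope.

(* The L^p space of the library, [LspaceType mu p1], is the quotient of the
   measurable functions by almost everywhere equality, restricted to finite
   p-norm; it carries no algebraic structure there. It is made here into a
   normed module, with operations on classes and the p-norm, which for
   p = +oo is the essential supremum of the absolute value. The coercion of
   [u : LspaceType mu p1] to a function is a chosen representative of u. *)
Section Lspace_normed.
Context d (T : measurableType d) (R : realType).
Variables (mu : {measure set T -> \bar R}) (p : \bar R) (p1 : (1 <= p)%E).
Local Open Scope quotient_scope.
Local Notation F := (LfunType mu p1).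
Local Notation L := (LspaceType mu p1).

Let measurable_mfun (f : F) :
  measurable_fun setT (f : T -> measurableTypeR R).
Proof. exact: measurable_funPT f. Qed.

(* [LspaceType] is built over functions into [measurableTypeR R], which carries
   the Borel sets of R under another display: hence the repackaging. *)
Definition Lclass_mfun (f : F) : {mfun_ mu, T >-> measurableTypeR R} :=
  \pi_({mfun_ mu, T >-> measurableTypeR R})
    (MeasurableFun.Pack (MeasurableFun.Class
      (@isMeasurableFun.Build _ _ T (measurableTypeR R) _ (measurable_mfun f)))).

Lemma Lclass_mfunE (f : F) : Lclass_mfun f = f %[ae mu].
Proof.
have /eqmodP/asboolP := reprK (Lclass_mfun f).
done.
Qed.

Let measurable_aefun (u : {mfun_ mu, T >-> measurableTypeR R}) :
  measurable_fun setT (u : T -> R).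
Proof. exact: measurable_funPT (repr u). Qed.

Lemma ae_eq_Lnorm (f g : T -> R) :
  measurable_fun setT f -> measurable_fun setT g -> f = g %[ae mu] ->
  ('N[mu]_p[EFin \o f] = 'N[mu]_p[EFin \o g])%E.
Proof.
move=> mf mg fg; rewrite unlock /Lnorm; case: p p1 => [r _|_|//].
- have mpow (h : T -> R) : measurable_fun setT h ->
      measurable_fun setT (fun x => `|(EFin \o h) x| `^ r)%E.
    move=> mh; have mh' : measurable_fun setT (abse \o (EFin \o h)).
      by apply: measurableT_comp => //; exact/measurable_EFinP.
    exact: (measurableT_comp (measurable_poweR r) mh').
  congr (_ `^ _)%E; apply: ae_eq_integral => //; [exact: mpow|exact: mpow|].
  by apply: filterS fg => x /= fgx /fgx ->.
- case: ifPn => // mu0; apply: eq_ess_sup.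
  by apply: filterS fg => x /= /(_ I) ->.
Qed.

Let Lclass_finite (f : F) : finite_norm mu p (Lclass_mfun f).
Proof.
rewrite /finite_norm (ae_eq_Lnorm _ _ (Lclass_mfunE f)) //.
exact: Lfunction_finite.
Qed.

Definition Lclass (f : F) : L :=
  LebesgueSpace.Pack (LebesgueSpace.Class
    (@isFinLebesgue.Axioms_ d T R mu p p1 _ (Lclass_finite f))).

Let Lrepr_mem (u : L) : (u : T -> R) \in Lfun mu p.
Proof.
rewrite inE; apply/andP; split; rewrite inE /=.
  exact: measurable_aefun.
exact: (@Lebesgue_finite d T R mu p p1 u).
Qed.

Definition Lrepr (u : L) : F := Lfun_Sub p1 (Lrepr_mem u).

Lemma LreprE (u : L) : Lrepr u = u :> (T -> R).
Proof. by []. Qed.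

Lemma LclassE (f : F) : Lclass f = f %[ae mu].
Proof. exact: Lclass_mfunE. Qed.

Lemma Lspace_eqP (u v : L) : u = v <-> u = v %[ae mu].
Proof.
split=> [->|]; first exact: ae_eq_refl.
case: u => u [[hu]]; case: v => v [[hv]] /= uv.
have E : u = v.
  rewrite -[u]reprK -[v]reprK; apply/eqmodP/asboolP.
  exact: uv.
case: _ / E in hv uv *.
by rewrite (Prop_irrelevance hu hv).
Qed.

Lemma Lclass_eqP (f g : F) : Lclass f = Lclass g <-> f = g %[ae mu].
Proof.
rewrite Lspace_eqP; split => h.
  apply: ae_eq_trans (LclassE g).
  by apply: ae_eq_trans h; exact/ae_eq_sym/LclassE.
apply: (ae_eq_trans (LclassE f)); apply: (ae_eq_trans h).
exact/ae_eq_sym/LclassE.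
Qed.

Lemma LreprK : cancel Lrepr Lclass.
Proof. by move=> u; apply/Lspace_eqP; exact: LclassE. Qed.

Lemma LclassK (f : F) : Lrepr (Lclass f) = f %[ae mu].
Proof. exact: LclassE. Qed.

HB.instance Definition _ := gen_eqMixin L.
HB.instance Definition _ := gen_choiceMixin L.

Definition Lspace0 : L := Lclass 0.
Definition Lspace_opp (u : L) : L := Lclass (- Lrepr u).
Definition Lspace_add (u v : L) : L := Lclass (Lrepr u + Lrepr v).
Definition Lspace_scale (a : R) (u : L) : L := Lclass (a *: Lrepr u).

Lemma Lspace_oppE (f : F) : Lspace_opp (Lclass f) = Lclass (- f).
Proof.
apply/Lclass_eqP; apply: filterS (LclassK f) => x /= /[apply] fx.
change (- (Lclass_mfun f x : R) = - f x); by rewrite fx.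
Qed.

Lemma Lspace_addE (f g : F) :
  Lspace_add (Lclass f) (Lclass g) = Lclass (f + g).
Proof.
apply/Lclass_eqP; apply: filterS2 (LclassK f) (LclassK g) => x /= + + Dx.
move=> /(_ Dx) fx /(_ Dx) gx.
change ((Lclass_mfun f x : R) + (Lclass_mfun g x : R) = f x + g x).
by rewrite fx gx.
Qed.

Lemma Lspace_scaleE (a : R) (f : F) :
  Lspace_scale a (Lclass f) = Lclass (a *: f).
Proof.
apply/Lclass_eqP; apply: filterS (LclassK f) => x /= /[apply] fx.
change (a * (Lclass_mfun f x : R) = a * f x); by rewrite fx.
Qed.

Lemma Lspace_addA : associative Lspace_add.
Proof.
move=> u v w; rewrite -[u]LreprK -[v]LreprK -[w]LreprK.
by rewrite !Lspace_addE addrA.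
Qed.

Lemma Lspace_addC : commutative Lspace_add.
Proof.
by move=> u v; rewrite -[u]LreprK -[v]LreprK !Lspace_addE addrC.
Qed.

Lemma Lspace_add0 : left_id Lspace0 Lspace_add.
Proof. by move=> u; rewrite -[u]LreprK Lspace_addE add0r. Qed.

Lemma Lspace_addN : left_inverse Lspace0 Lspace_opp Lspace_add.
Proof.
by move=> u; rewrite -[u]LreprK Lspace_oppE Lspace_addE addNr.
Qed.

HB.instance Definition _ := GRing.isZmodule.Build L
  Lspace_addA Lspace_addC Lspace_add0 Lspace_addN.

Lemma LclassD (f g : F) : Lclass (f + g) = Lclass f + Lclass g.
Proof. by rewrite -Lspace_addE. Qed.

Lemma Lspace_scaleA a b (u : L) :
  Lspace_scale a (Lspace_scale b u) = Lspace_scale (a * b) u.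
Proof. by rewrite -[u]LreprK !Lspace_scaleE scalerA. Qed.

Lemma Lspace_scale1 : left_id 1 Lspace_scale.
Proof. by move=> u; rewrite -[u]LreprK Lspace_scaleE scale1r. Qed.

Lemma Lspace_scaleDr : right_distributive Lspace_scale +%R.
Proof.
move=> a u v; rewrite -[u]LreprK -[v]LreprK -LclassD !Lspace_scaleE.
by rewrite -LclassD scalerDr.
Qed.

Lemma Lspace_scaleDl (u : L) : {morph Lspace_scale^~ u : a b / a + b}.
Proof.
by move=> a b; rewrite -[u]LreprK !Lspace_scaleE -LclassD scalerDl.
Qed.

HB.instance Definition _ := GRing.Zmodule_isLmodule.Build R L
  Lspace_scaleA Lspace_scale1 Lspace_scaleDr Lspace_scaleDl.

Lemma LclassZ a (f : F) : Lclass (a *: f) = a *: Lclass f.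
Proof. by rewrite -Lspace_scaleE. Qed.

Definition Lspace_norm (u : L) : R := fine ('N[mu]_p[EFin \o u])%E.

Lemma Lspace_normE (f : F) :
  Lspace_norm (Lclass f) = fine ('N[mu]_p[EFin \o f])%E.
Proof.
congr fine; apply: ae_eq_Lnorm; [|exact: measurable_funPT|exact: LclassE].
exact: measurable_aefun.
Qed.

Lemma ler_Lspace_normD u v :
  Lspace_norm (u + v) <= Lspace_norm u + Lspace_norm v.
Proof.
rewrite -[u]LreprK -[v]LreprK -LclassD !Lspace_normE.
exact: ler_LnormD.
Qed.

Lemma Lspace_normZ a u : Lspace_norm (a *: u) = `|a| * Lspace_norm u.
Proof.
rewrite -[u]LreprK -LclassZ !Lspace_normE (LnormZ (Lrepr u) a).
by rewrite -finite_norm_fine.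
Qed.

Lemma Lspace_norm_eq0 u : Lspace_norm u = 0 -> u = 0.
Proof.
rewrite -[u]LreprK Lspace_normE => /fine_Lnormr_eq0 u0.
exact/Lclass_eqP.
Qed.

HB.instance Definition _ := Lmodule_isNormed.Build R L
  ler_Lspace_normD Lspace_normZ Lspace_norm_eq0.

End Lspace_normed.
Arguments Lclass {d T R mu p p1} f.
Arguments Lrepr {d T R mu p p1} u.

Section outer_lebesgue.
Context (R : realType) (n : nat).
Local Open Scope ereal_scope.
Implicit Types (c : 'rV[R]_n * 'rV[R]_n) (A B X : set 'rV[R]_n).

Definition obox c : set 'rV[R]_n :=
  [set x | forall i, (c.1 ord0 i < x ord0 i <= c.2 ord0 i)%R].

Definition box_vol c : R :=
  (\prod_(i < n) Num.max 0 (c.2 ord0 i - c.1 ord0 i))%R.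

(* The covers are indexed by subsets of nat, so that empty covers are allowed:
   in dimension 0 every box has volume 1. *)
Definition outer_lebesgue A : \bar R :=
  ereal_inf [set \esum_(k in Dc.1) (box_vol (Dc.2 k))%:E |
    Dc in [set Dc : set nat * ('rV[R]_n * 'rV[R]_n)^nat |
      A `<=` \bigcup_(k in Dc.1) obox (Dc.2 k)]].

Lemma box_vol_ge0 c : (0 <= box_vol c)%R.
Proof. by apply: prodr_ge0 => i _; rewrite le_max lexx. Qed.

Lemma outer_lebesgue_ge0 A : 0 <= outer_lebesgue A.
Proof.
apply: le_ereal_inf_tmp => _ [c _ <-].
by apply: esum_ge0 => k _; rewrite lee_fin box_vol_ge0.
Qed.

Lemma outer_lebesgue_le A (D : set nat) (c : ('rV[R]_n * 'rV[R]_n)^nat) :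
  A `<=` \bigcup_(k in D) obox (c k) ->
  outer_lebesgue A <= \esum_(k in D) (box_vol (c k))%:E.
Proof. by move=> Ac; apply: ereal_inf_lbound; exists (D, c). Qed.

Lemma outer_lebesgue0 : outer_lebesgue set0 = 0.
Proof.
apply/eqP; rewrite eq_le outer_lebesgue_ge0 andbT.
apply: (le_trans (@outer_lebesgue_le set0 set0 (fun=> (0, 0)%R) _)) => //.
by rewrite esum_set0.
Qed.

Lemma le_outer_lebesgue : {homo outer_lebesgue : A B / A `<=` B >-> A <= B}.
Proof.
move=> A B AB; apply: ereal_inf_le_tmp => _ [c Bc <-].
by exists c => //; exact: subset_trans Bc.
Qed.

Lemma outer_lebesgue_sigma_subadditive : sigma_subadditive outer_lebesgue.
Proof.
move=> A; have [[i ioo]|] := pselect (exists i, outer_lebesgue (A i) = +oo).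
  rewrite (eseries_pinfty _ _ ioo) ?leey// => k _.
  by rewrite -ltNye (lt_le_trans _ (outer_lebesgue_ge0 _)).
rewrite -forallNE => Aoo.
apply/lee_addgt0Pr => e e0.
apply: le_trans (epsilon_trick xpredT _ (ltW e0)); last first.
  by move=> k; exact: outer_lebesgue_ge0.
pose P k (Dc : set nat * ('rV[R]_n * 'rV[R]_n)^nat) :=
  A k `<=` \bigcup_(j in Dc.1) obox (Dc.2 j) /\
  \esum_(j in Dc.1) (box_vol (Dc.2 j))%:E <=
    outer_lebesgue (A k) + (e / (2 ^ k.+1)%:R)%:E.
have [G PG] : {G & forall k, P k (G k)}.
  apply: (@choice _ _ P) => k; have ek : (0 < e / (2 ^ k.+1)%:R)%R.
    by rewrite divr_gt0.
  have Afin : outer_lebesgue (A k) \is a fin_num.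
    by rewrite ge0_fin_numE ?outer_lebesgue_ge0// ltey; exact/eqP/Aoo.
  have [_ [Dc ADc <-] lt] := lb_ereal_inf_adherent ek Afin.
  by exists Dc; split => //; exact: ltW.
have /card_esym/ppcard_eqP[f] := card_nat2.
pose c' k := (G (f k).1).2 (f k).2.
pose D' := [set k | (G (f k).1).1 (f k).2].
apply: (@le_trans _ _ (\esum_(k in D') (box_vol (c' k))%:E)).
  apply: outer_lebesgue_le => x [k _ /((PG k).1) [j Dj xj]].
  by exists (f^-1%FUN (k, j)); rewrite /D' /c' /= invK ?inE.
rewrite (_ : \esum_(k in D') _ =
    \esum_(p in setT `*`` (fun k => (G k).1)) (box_vol ((G p.1).2 p.2))%:E);
    last first.
  apply/esym/(@reindex_esum _ _ _ D' _ f); split.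
  - by move=> k /= Dk; split.
  - by move=> x y _ _; exact: (inj (f := f)) (in_setT _) (in_setT _).
  - move=> [k j] [_ /= Dj]; exists (f^-1%FUN (k, j)); rewrite /D' /= ?invK ?inE//.
rewrite -(@esum_esum _ _ _ setT (fun k => (G k).1)
  (fun k j => (box_vol ((G k).2 j))%:E)); last first.
  by move=> *; rewrite lee_fin box_vol_ge0.
rewrite nneseries_esumT; last first.
  by move=> k; rewrite adde_ge0 ?outer_lebesgue_ge0// lee_fin divr_ge0// ltW.
by apply: le_esum => k _; exact: (PG k).2.
Qed.

HB.instance Definition _ := isOuterMeasure.Build R 'rV[R]_n outer_lebesgue
  outer_lebesgue0 outer_lebesgue_ge0 le_outer_lebesgue
  outer_lebesgue_sigma_subadditive.

Definition shift_box (t : 'rV[R]_n) c := (c.1 + t, c.2 + t)%R.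

Lemma box_vol_shift t c : box_vol (shift_box t c) = box_vol c.
Proof.
apply: eq_bigr => i _; rewrite !mxE; congr (Num.max _ _).
by rewrite opprD addrACA subrr addr0.
Qed.

Let outer_lebesgue_shift_le A (t : 'rV[R]_n) :
  outer_lebesgue [set x | A (x - t)%R] <= outer_lebesgue A.
Proof.
apply: le_ereal_inf_tmp => _ [[D c] /= Ac <-].
under eq_esum do rewrite -(box_vol_shift t).
apply: outer_lebesgue_le => x /Ac[k Dk] xk; exists k => // i.
by have := xk i; rewrite !mxE ltrBrDr lerBlDr.
Qed.

Lemma outer_lebesgue_shift A (t : 'rV[R]_n) :
  outer_lebesgue [set x | A (x - t)%R] = outer_lebesgue A.
Proof.
apply/eqP; rewrite eq_le outer_lebesgue_shift_le/=.
apply: le_trans (outer_lebesgue_shift_le [set x | A (x - t)%R] (- t)%R).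
by apply: le_outer_lebesgue => x Ax /=; rewrite opprK addrK.
Qed.

Lemma caratheodory_shift A (t : 'rV[R]_n) :
  outer_lebesgue.-caratheodory A ->
  outer_lebesgue.-caratheodory [set x | A (x - t)%R].
Proof.
move=> mA X; have XE : X = [set x | [set y | X (y + t)%R] (x - t)%R].
  by apply/seteqP; split => x /=; rewrite subrK.
rewrite [in LHS]XE outer_lebesgue_shift (mA _).
rewrite -[in RHS](outer_lebesgue_shift _ (- t)%R).
rewrite -[X in _ = _ + X](outer_lebesgue_shift _ (- t)%R).
by congr (outer_lebesgue _ + outer_lebesgue _); apply/seteqP;
  split => x /=; rewrite opprK addrK.
Qed.

Let cut_lo (i : 'I_n) (t : R) c : 'rV[R]_n * 'rV[R]_n :=
  (c.1, \row_j if j == i then Num.min (c.2 ord0 j) t else c.2 ord0 j).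
Let cut_hi (i : 'I_n) (t : R) c : 'rV[R]_n * 'rV[R]_n :=
  (\row_j (if j == i then Num.max (c.1 ord0 j) t else c.1 ord0 j), c.2).

Let box_vol_cut i t c :
  (box_vol (cut_lo i t c) + box_vol (cut_hi i t c) = box_vol c)%R.
Proof.
have volE c' : box_vol c' = (Num.max 0 (c'.2 ord0 i - c'.1 ord0 i) *
    \prod_(j < n | j != i) Num.max 0 (c'.2 ord0 j - c'.1 ord0 j))%R.
  by rewrite /box_vol (bigD1 i).
rewrite !volE /=.
under eq_bigr => j ji do rewrite mxE (negbTE ji).
under [X in (_ + _ * X)%R]eq_bigr => j ji do rewrite mxE (negbTE ji).
rewrite -mulrDl !mxE eqxx; congr (_ * _)%R.
move: (c.1 ord0 i) (c.2 ord0 i) => a b; rewrite !maxEle !minEle.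
by repeat case: ifPn; rewrite -?ltNge => *; lra.
Qed.

Lemma caratheodory_halfspace (i : 'I_n) (t : R) :
  outer_lebesgue.-caratheodory [set x | (x ord0 i <= t)%R].
Proof.
apply: le_caratheodory_measurable => X.
apply: le_ereal_inf_tmp => _ [[D c] /= Xc <-].
have -> : \esum_(k in D) (box_vol (c k))%:E =
    \esum_(k in D) (box_vol (cut_lo i t (c k)))%:E +
    \esum_(k in D) (box_vol (cut_hi i t (c k)))%:E.
  rewrite -esumD; [|by move=> *; rewrite lee_fin box_vol_ge0..].
  by apply: eq_esum => k _; rewrite -EFinD box_vol_cut.
apply: leeD; apply: outer_lebesgue_le => x [/Xc[k Dk] xk].
- move=> /= xit; exists k => // j; have /andP[jl jr] := xk j.
  by rewrite !mxE jl/=; case: eqP => // ->; rewrite le_min xit andbT;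
    case/andP: (xk i).
- move=> /= /negP; rewrite -ltNge => xit; exists k => // j.
  have /andP[jl jr] := xk j.
  by rewrite !mxE jr andbT; case: eqP => // ->; rewrite gt_max xit andbT;
    case/andP: (xk i).
Qed.

End outer_lebesgue.

Notation Linfty mu := (LspaceType mu (leey 1%E)).

Section Linfty.
Context d (T : measurableType d) (R : realType).
Variable mu : {measure set T -> \bar R}.

Lemma Linfty_ae_bounded (u : Linfty mu) :
  exists M : R, \forall x \ae mu, `|u x : R| <= M.
Proof.
have := Lfunction_finite _ (Lrepr u).
rewrite /finite_norm unlock /Lnorm; case: ifPn => [mu0 supoo|].
  exists (fine (ess_sup mu (abse \o (EFin \o Lrepr u)))).
  apply: filterS (ess_sup_ge mu (abse \o (EFin \o Lrepr u))) => x /= ux.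
  rewrite -lee_fin fineK//= ge0_fin_numE//.
  exact: le_trans ux.
rewrite -leNgt measure_le0 => /eqP muT _; exists 0.
by exists setT; split.
Qed.

Lemma ae_bounded_Lfun (f : T -> R) : measurable_fun setT f ->
  (exists M : R, \forall x \ae mu, `|f x| <= M) -> f \in Lfun mu +oo%E.
Proof.
move=> mf [M fM]; rewrite inE; apply/andP; split; rewrite inE //=.
rewrite /finite_norm unlock /Lnorm; case: ifPn => // _.
apply: (@le_lt_trans _ _ M%:E); last exact: ltry.
by apply/ess_supP; apply: filterS fM => x /=; rewrite lee_fin.
Qed.

Definition to_Linfty (f : T -> R) (mf : measurable_fun setT f)
    (bf : exists M : R, \forall x \ae mu, `|f x| <= M) : Linfty mu :=
  Lclass (Lfun_Sub (leey 1%E) (ae_bounded_Lfun mf bf)).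

End Linfty.

(* R^n with its Lebesgue (not only Borel) sigma-algebra: the sets measurable in
   the sense of Caratheodory for the outer measure. *)
Section Rn.
Context (R : realType) (n : nat).

Definition Rn : Type := caratheodory_type (@outer_lebesgue R n).
HB.instance Definition _ := Measurable.on Rn.

Definition lebesgue_Rn : set Rn -> \bar R := @outer_lebesgue R n.
HB.instance Definition _ := isMeasure.Build _ Rn R lebesgue_Rn
  (@caratheodory_measure0 R 'rV[R]_n (@outer_lebesgue R n))
  (@caratheodory_measure_ge0 R 'rV[R]_n (@outer_lebesgue R n))
  (@caratheodory_measure_sigma_additive R 'rV[R]_n (@outer_lebesgue R n)).

Lemma lebesgue_Rn_shift (A : set Rn) (t : 'rV[R]_n) : measurable A ->
  measurable ([set x : 'rV[R]_n | A (x - t)] : set Rn).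
Proof. exact: caratheodory_shift. Qed.

Lemma ae_shift (P : set Rn) (t : 'rV[R]_n) : (\forall x \ae lebesgue_Rn, P x) ->
  \forall x \ae lebesgue_Rn, P ((x : 'rV[R]_n) - t).
Proof.
move=> [A [mA A0 PA]]; exists [set x : 'rV[R]_n | A (x - t)]; split.
- exact: lebesgue_Rn_shift.
- by rewrite -[RHS]A0; exact: outer_lebesgue_shift.
- by move=> x /= Px; exact: PA.
Qed.

Definition shift_fun (t : 'rV[R]_n) (u : Rn -> R) : Rn -> R :=
  fun x => u ((x : 'rV[R]_n) - t).

Lemma measurable_shift_fun t u : measurable_fun setT u ->
  measurable_fun setT (shift_fun t u).
Proof.
move=> mu _ Y mY; rewrite setTI.
apply: (@lebesgue_Rn_shift (u @^-1` Y) t).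
by rewrite -[X in measurable X]setTI; exact: mu.
Qed.

Let shift_bounded (t : 'rV[R]_n) (u : Linfty lebesgue_Rn) :
  exists M : R, \forall x \ae lebesgue_Rn, `|shift_fun t u x| <= M.
Proof.
have [M uM] := Linfty_ae_bounded u; exists M.
exact: (@ae_shift [set x | `|u x : R| <= M]).
Qed.

Let measurable_shift (t : 'rV[R]_n) (u : Linfty lebesgue_Rn) :
  measurable_fun setT (shift_fun t u).
Proof.
apply: measurable_shift_fun; exact: (measurable_funPT (Lrepr u)).
Qed.

Definition translate (t : 'rV[R]_n) (u : Linfty lebesgue_Rn) :
    Linfty lebesgue_Rn :=
  to_Linfty (measurable_shift t u) (shift_bounded t u).

Lemma measurable_coord (i : 'I_n) :
  measurable_fun setT (fun x : Rn => (x : 'rV[R]_n) ord0 i).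
Proof.
apply: (measurability (@RGenOInfty.G R)).
  exact: RGenOInfty.measurableE.
move=> _ [_ [r ->] <-]; rewrite setTI.
rewrite (_ : _ @^-1` _ = ~` [set x : 'rV[R]_n | x ord0 i <= r]).
  apply: measurableC; exact: caratheodory_halfspace.
by apply/seteqP; split => x /=; rewrite in_itv/= andbT ltNge => /negP.
Qed.

(* The norm of the library on 'rV[R]_n is the sup norm, so Euclidean balls are
   spelled out. *)
Definition eucl_ball (x : R) : set Rn :=
  [set y : 'rV[R]_n | Num.sqrt (\sum_i y ord0 i ^+ 2) < x].

Lemma measurable_eucl_ball (x : R) : measurable (eucl_ball x).
Proof.
have [x0|x0] := leP x 0.
  rewrite (_ : eucl_ball x = set0); first exact: measurable0.
  apply/seteqP; split=> y //=; rewrite /eucl_ball /=.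
  by move=> /lt_le_trans/(_ x0); rewrite ltNge sqrtr_ge0.
have mS : measurable_fun setT
    (fun y : Rn => \sum_i (y : 'rV[R]_n) ord0 i ^+ 2).
  by apply: measurable_sum => i; apply: measurable_funX; exact: measurable_coord.
rewrite (_ : eucl_ball x =
    (fun y : Rn => \sum_i (y : 'rV[R]_n) ord0 i ^+ 2) @^-1` `]-oo, x ^+ 2[).
  by rewrite -[X in measurable X]setTI; exact: mS.
have sqrtE r : (Num.sqrt r < x) = (r < x ^+ 2).
  by rewrite -[in LHS](ger0_norm (ltW x0)) -sqrtr_sqr ltr_sqrt // exprn_gt0.
by apply/seteqP; split => y /=; rewrite /eucl_ball /= in_itv/= sqrtE.
Qed.

Lemma lebesgue_Rn_eucl_ball_lty (x : R) : (lebesgue_Rn (eucl_ball x) < +oo)%E.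
Proof.
pose c : 'rV[R]_n * 'rV[R]_n := (\row_i (- x), \row_i x).
apply: (@le_lt_trans _ _ (box_vol c)%:E); last exact: ltry.
rewrite -[leRHS](@esum_set1 R _ 0%N (fun=> (box_vol c)%:E)); last first.
  by rewrite lee_fin box_vol_ge0.
apply: (@outer_lebesgue_le _ _ _ [set 0%N] (fun=> c)) => y yx.
exists 0%N => // i; rewrite /c/= !mxE.
have : `|y ord0 i| < x.
  apply: le_lt_trans yx; rewrite -sqrtr_sqr ler_wsqrtr//.
  by rewrite (bigD1 i)//= lerDl sumr_ge0// => j _; exact: sqr_ge0.
by rewrite ltr_norml => /andP[-> /ltW].
Qed.

Lemma subset_eucl_ball (x y : R) : x <= y -> eucl_ball x `<=` eucl_ball y.
Proof. by move=> xy z; rewrite /eucl_ball /= => /lt_le_trans; exact. Qed.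

Definition cesaro_fun (u : Rn -> R) (x : R) : R :=
  if 0 < x then
    (fine (lebesgue_Rn (eucl_ball x)))^-1 *
      \int[lebesgue_Rn]_(y in eucl_ball x) u y
  else 0.

Lemma Linfty_integrable_eucl_ball (u : Linfty lebesgue_Rn) (x : R) :
  lebesgue_Rn.-integrable (eucl_ball x) (EFin \o (u : Rn -> R)).
Proof.
have mu : measurable_fun setT (u : Rn -> R) := measurable_funPT (Lrepr u).
have mux : measurable_fun (eucl_ball x) (EFin \o (u : Rn -> R)).
  by apply/measurable_EFinP; exact: measurable_funTS.
have mB := measurable_eucl_ball x.
apply/integrableP; split => //.
have [M uM] := Linfty_ae_bounded u.
apply: (@le_lt_trans _ _
    (\int[lebesgue_Rn]_(y in eucl_ball x) (Num.max 0 M)%:E)%E).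
  apply: ae_ge0_le_integral => //.
  - exact: measurableT_comp.
  - by move=> y _; rewrite lee_fin le_max lexx.
  - by apply: filterS uM => y /= uy _; rewrite lee_fin le_max uy orbT.
rewrite integral_cst// lte_mul_pinfty//; last exact: lebesgue_Rn_eucl_ball_lty.
by rewrite lee_fin le_max lexx.
Qed.

End Rn.
Arguments Rn : clear implicits.
Arguments lebesgue_Rn : clear implicits.
Arguments eucl_ball {R} n x.

Section cesaro.
Context (R : realType) (n : nat).
Local Notation mu := (lebesgue_Rn R n).
Local Notation nu := (@completed_lebesgue_measure R).

Let fine_mu_mono : nondecreasing_fun (fun x => fine (mu (eucl_ball n x))).
Proof.
move=> x y xy; apply: fine_le.
- by rewrite ge0_fin_numE ?lebesgue_Rn_eucl_ball_lty// outer_lebesgue_ge0.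
- by rewrite ge0_fin_numE ?lebesgue_Rn_eucl_ball_lty// outer_lebesgue_ge0.
- by apply: le_outer_lebesgue; exact: subset_eucl_ball.
Qed.

Let measurable_Rintegral_ball (u : Linfty mu) :
  measurable_fun setT (fun x => \int[mu]_(y in eucl_ball n x) (u y : R)).
Proof.
have mu_ : measurable_fun setT (u : Rn R n -> R) := measurable_funPT (Lrepr u).
have mux : measurable_fun setT (EFin \o (u : Rn R n -> R)).
  exact/measurable_EFinP.
have fin_p x := integrable_pos_fin_num (measurable_eucl_ball x)
  (Linfty_integrable_eucl_ball u x).
have fin_n x := integrable_neg_fin_num (measurable_eucl_ball x)
  (Linfty_integrable_eucl_ball u x).
rewrite (_ : (fun x => _) =
    (fun x => fine (\int[mu]_(y in eucl_ball n x) (EFin \o (u : Rn R n -> R))^\+ y)%E) \-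
    (fun x => fine (\int[mu]_(y in eucl_ball n x) (EFin \o (u : Rn R n -> R))^\- y)%E)).
  apply: measurable_funB; apply: nondecreasing_measurable => // x y xy.
  - apply: fine_le => //; apply: ge0_subset_integral => //.
    + exact: measurable_eucl_ball.
    + exact: measurable_eucl_ball.
    + by apply: measurable_funTS; exact: measurable_funepos.
    + exact: subset_eucl_ball.
  - apply: fine_le => //; apply: ge0_subset_integral => //.
    + exact: measurable_eucl_ball.
    + exact: measurable_eucl_ball.
    + by apply: measurable_funTS; exact: measurable_funeneg.
    + exact: subset_eucl_ball.
by apply/funext => x /=; rewrite /Rintegral integralE fineB.
Qed.

Lemma cesaro_fun_ae_eq (f g : Rn R n -> R) :
  measurable_fun setT f -> measurable_fun setT g -> f = g %[ae mu] ->
  cesaro_fun f = cesaro_fun g.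
Proof.
move=> mf mg fg; apply/funext => x; rewrite /cesaro_fun; case: ifPn => // _.
congr (_ * fine _); apply: ae_eq_integral; first exact: measurable_eucl_ball.
- by apply/measurable_EFinP; exact: measurable_funTS.
- by apply/measurable_EFinP; exact: measurable_funTS.
- by apply: filterS fg => y /(_ I) fgy _; rewrite fgy.
Qed.

Lemma measurable_cesaro_fun (u : Linfty mu) :
  measurable_fun setT (cesaro_fun (u : Rn R n -> R)).
Proof.
apply: measurable_fun_ifT => //; first exact: measurable_fun_ltr.
apply: measurable_funM; last exact: measurable_Rintegral_ball.
rewrite (_ : (fun x => _) =
    (fun x => fine (mu (eucl_ball n x)) `^ (-1))).
  have mm := nondecreasing_measurable (@measurableT _ R) fine_mu_mono.
  exact: (measurableT_comp (measurable_powR (-1)) mm).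
by apply/funext => x; rewrite powR_inv1 ?fine_ge0.
Qed.

Lemma cesaro_fun_Lfun (u : Linfty mu) :
  (cesaro_fun (u : Rn R n -> R)) \in Lfun nu +oo%E.
Proof.
apply: ae_bounded_Lfun.
  move=> _ Y mY; rewrite setTI.
  apply: sub_caratheodory.
  by have := measurable_cesaro_fun u measurableT mY; rewrite setTI.
have [M uM] := Linfty_ae_bounded u; exists (Num.max 0 M); apply/nearW => x.
rewrite /cesaro_fun; case: ifPn => x0; last by rewrite normr0 le_max lexx.
set B := eucl_ball n x; have mB : measurable B := measurable_eucl_ball x.
have intu := Linfty_integrable_eucl_ball u x.
have Bfin : mu B \is a fin_num.
  by rewrite ge0_fin_numE ?lebesgue_Rn_eucl_ball_lty// outer_lebesgue_ge0.
have M0 : 0 <= Num.max 0 M by rewrite le_max lexx.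
have int_le : `|\int[mu]_(y in B) (u y : R)| <= Num.max 0 M * fine (mu B).
  apply: (le_trans (le_normr_Rintegral mB intu)).
  have -> : Num.max 0 M * fine (mu B) =
      fine (\int[mu]_(y in B) (Num.max 0 M)%:E)%E.
    by rewrite integral_cst// fineM.
  apply: fine_le.
  - by apply: integrable_fin_num => //; exact: (integrable_norm intu).
  - by rewrite integral_cst// fin_numM.
  apply: (@ae_ge0_le_integral _ _ _ mu B mB
      (fun y => (`|u y : R|)%:E) (fun=> (Num.max 0 M)%:E)).
  - by move=> y _; rewrite lee_fin.
  - by case/integrableP: (integrable_norm intu).
  - by move=> y _; rewrite lee_fin.
  - exact: measurable_cst.
  - by apply: filterS uM => y /= uy _; rewrite lee_fin le_max uy orbT.
rewrite normrM; have [m0|m0] := eqVneq (fine (mu B)) 0.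
  by rewrite m0 invr0 normr0 mul0r.
have mgt0 : 0 < fine (mu B) by rewrite lt0r m0 fine_ge0// outer_lebesgue_ge0.
by rewrite gtr0_norm ?invr_gt0// mulrC ler_pdivrMr.
Qed.

Definition cesaro (u : Linfty mu) : Linfty nu :=
  Lclass (Lfun_Sub (leey 1%E) (cesaro_fun_Lfun u)).

End cesaro.

Definition is_ultrafilter (T : Type) (U : set_system T) : Prop :=
  ProperFilter U /\ forall A : set T, U A \/ U (~` A).

Lemma is_ultrafilterP (T : Type) (U : set_system T) :
  is_ultrafilter U <-> UltraFilter U.
Proof.
split=> [[PU UA]|UU]; last first.
  by split=> [|A]; [exact: ultra_proper|exact: in_ultra_setVsetC].
split=> // G PG UG; apply/seteqP; split=> // A GA.
by have [//|/UG GnA] := UA A; have [] := @filter_not_empty _ G _;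
  rewrite -(setICr A); exact: filterI.
Qed.

Section right_lebesgue_ultrafilter.
Context (R : realType).
Local Notation nu := (@completed_lebesgue_measure R).

Definition right_lebesgue_ultrafilter (U : set_system R) : Prop :=
  [/\ is_ultrafilter U,
      forall N : set R, nu.-negligible N -> U (~` N) &
      forall a : R, U `]a, +oo[%classic].

(* By [ulim_cvg] and [ulim_unique] this is the real number l, unique and
   independent of the representative of v, such that |v - l| < e on a set of U,
   for every e > 0. *)
Definition ulim (U : set_system R) (v : Linfty nu) : R :=
  lim ((fun x : R => v x : R) @ U).

Lemma ulim_cvg (U : set_system R) (v : Linfty nu) :
  right_lebesgue_ultrafilter U -> (fun x : R => v x : R) @ U --> ulim U v.
Proof.
move=> [uU nullU _]; have [PU UA] := uU; have [M vM] := Linfty_ae_bounded v.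
pose w (x : R) : R := v x.
have Uw : UltraFilter (w @ U).
  by apply/is_ultrafilterP; split=> [|A]; [exact: fmap_proper_filter|exact: UA].
have := @segment_compact R (- M) M; rewrite compact_ultra => /(_ _ Uw)[].
  have Uv : U [set x | `|w x| <= M] by have := nullU _ vM; rewrite setCK.
  by apply: (@filterS R U _ _ _ _ Uv) => x /=; rewrite in_itv/= -ler_norml.
by move=> l [_ wl]; apply: cvgP wl.
Qed.

Lemma ulim_unique (U : set_system R) (v : Linfty nu) (f : R -> R) (l : R) :
  right_lebesgue_ultrafilter U -> f = v %[ae nu] ->
  (forall e, 0 < e -> U [set x : R | `|f x - l| < e]) -> ulim U v = l.
Proof.
move=> [[PU _] nullU _] fv vl; apply: cvg_lim => //.
have Ufv : U [set x | f x = v x].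
  have := nullU _ fv; rewrite setCK; apply: (@filterS R U) => x /=.
  by move=> /(_ I).
apply/cvgrPdist_lt => e /vl fl; apply: (@filterS2 R U _ _ _ _ _ Ufv fl) => x /=.
by move=> <-; rewrite distrC.
Qed.

Definition Blim (n : nat) (U : set_system R) (u : Linfty (lebesgue_Rn R n)) : R :=
  ulim U (cesaro u).

End right_lebesgue_ultrafilter.

(* Main.v *)
(* Linearity and monotonicity are inherited from the integral and the limit
   along U, and continuity follows from |Blim u| <= |u|. For translations,
   the ball B_r and its translate by -t lie between B_(r - S) and B_(r + S),
   where S is the l^1 norm of t. As |B_r| = r^n |B_1|, the averages of u and of
   its translate over B_r differ by at most
   2 |u| ((1 + S / r)^n - (1 - S / r)^n), which tends to 0 as r -> +oo, hence
   along U. *)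
Require Import Defs.
From mathcomp Require Import all_boot all_order all_algebra.
From mathcomp Require Import all_classical all_reals all_analysis.
From mathcomp Require Import ess_sup_inf measurable_realfun ring.
Set Implicit Arguments.
Unset Strict Implicit.
Unset Printing Implicit Defensive.
Import Order.TTheory GRing.Theory Num.Theory.
Import numFieldNormedType.Exports.
Local Open Scope classical_set_scope.
Local Open Scope ring_scope.

(** * Scaling and translation of Euclidean balls *)

Section ball_volume.
Context (R : realType) (n : nat).
Local Notation mu := (lebesgue_Rn R n).
Implicit Types (r s : R) (t y : 'rV[R]_n).

Lemma ge0_le_esumZl (T : choiceType) (D : set T) (a : T -> \bar R) r :
  0 <= r -> (forall i, 0 <= a i)%E ->
  (\esum_(i in D) (r%:E * a i) <= r%:E * \esum_(i in D) a i)%E.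
Proof.
move=> r0 a0; apply: ge_ereal_sup => _ [X [finX XD] <-].
rewrite -ge0_mule_fsumr//.
apply: lee_wpmul2l; first by rewrite lee_fin.
by apply: ereal_sup_ubound; exists X.
Qed.

(** Dilating a box cover of [A] by [r] covers the dilated set, and each box volume is multiplied by
    [r ^+ n]; then pass to the infimum over covers. *)
Lemma outer_lebesgue_scale_le (A : set 'rV[R]_n) r : 0 < r ->
  (outer_lebesgue [set x | A (r^-1 *: x)%R] <= (r ^+ n)%:E * outer_lebesgue A)%E.
Proof.
move=> r0; rewrite -lee_pdivrMl ?exprn_gt0//.
apply: le_ereal_inf_tmp => _ [[D c] /= Ac <-].
rewrite lee_pdivrMl ?exprn_gt0//.
pose c' k := (r *: (c k).1, r *: (c k).2).
have volE k : box_vol (c' k) = r ^+ n * box_vol (c k).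
  rewrite /box_vol -[in r ^+ n](card_ord n) -prodr_const -big_split/=.
  apply: eq_bigr => i _.
  by rewrite !mxE -mulrBr maxr_pMr ?(ltW r0)// mulr0.
apply: (@le_trans _ _ (\esum_(k in D) (box_vol (c' k))%:E)%E).
  apply: outer_lebesgue_le => x /Ac[k Dk] xk; exists k => // i.
  by have := xk i; rewrite !mxE ltr_pdivlMl// ler_pdivrMl.
under eq_esum do rewrite volE EFinM.
by apply: ge0_le_esumZl; [rewrite exprn_ge0 ?ltW|move=> k; rewrite lee_fin box_vol_ge0].
Qed.

Lemma eucl_ball_scale r s y : 0 < r ->
  eucl_ball n s (r^-1 *: y) <-> eucl_ball n (r * s) y.
Proof.
move=> r0; rewrite /eucl_ball/=.
under eq_bigr do rewrite mxE exprMn.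
rewrite -mulr_sumr sqrtrM ?sqr_ge0// sqrtr_sqr gtr0_norm ?invr_gt0//.
by rewrite ltr_pdivrMl.
Qed.

Definition ball_volume r : R := fine (mu (eucl_ball n r)).

Lemma lebesgue_Rn_eucl_ball_fin_num r : mu (eucl_ball n r) \is a fin_num.
Proof. by rewrite ge0_fin_numE ?lebesgue_Rn_eucl_ball_lty// measure_ge0. Qed.

Lemma lebesgue_Rn_eucl_ballE r : mu (eucl_ball n r) = (ball_volume r)%:E.
Proof. by rewrite fineK// lebesgue_Rn_eucl_ball_fin_num. Qed.

Lemma ball_volume_ge0 r : 0 <= ball_volume r.
Proof. exact: fine_ge0. Qed.

Let ball_volume_scale_le r s : 0 < r ->
  ball_volume (r * s) <= r ^+ n * ball_volume s.
Proof.
move=> r0; rewrite -lee_fin EFinM -!lebesgue_Rn_eucl_ballE.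
apply: le_trans (outer_lebesgue_scale_le _ r0).
by apply: le_outer_lebesgue => y /(eucl_ball_scale _ _ r0).
Qed.

(** One inequality dilates the unit ball by [r]; the other dilates the ball of radius [r] by [r^-1]
    back to radius [r^-1 * r = 1]. *)
Lemma ball_volumeE r : 0 < r -> ball_volume r = r ^+ n * ball_volume 1.
Proof.
move=> r0; apply/eqP; rewrite eq_le; apply/andP; split.
  by have := ball_volume_scale_le 1 r0; rewrite mulr1.
rewrite -ler_pdivlMl ?exprn_gt0// -exprVn.
by rewrite -[X in ball_volume X <= _](mulVf (lt0r_neq0 r0)) ball_volume_scale_le ?invr_gt0.
Qed.

(* The l^1 norm of t spares Cauchy-Schwarz, and any bound in terms of t will do. *)
Lemma eucl_ball_translate r t y :
  eucl_ball n r y -> eucl_ball n (r + \sum_i `|t ord0 i|) (y + t).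
Proof.
rewrite /eucl_ball/=; set N := Num.sqrt _; set S := (X in r + X) => yr.
have S0 : 0 <= S by apply: sumr_ge0 => i _; exact: normr_ge0.
have N0 : 0 <= N by exact: sqrtr_ge0.
apply: (@le_lt_trans _ _ (N + S)); last by rewrite ltrD2r.
rewrite -[leRHS]ger0_norm ?addr_ge0// -sqrtr_sqr ler_wsqrtr//.
have yN i : `|y ord0 i| <= N.
  rewrite /N -sqrtr_sqr ler_wsqrtr// (bigD1 i)//= lerDl.
  by apply: sumr_ge0 => j _; exact: sqr_ge0.
have tS i : `|t ord0 i| <= S.
  by rewrite /S (bigD1 i)//= lerDl sumr_ge0.
have NE : N ^+ 2 = \sum_i y ord0 i ^+ 2.
  by rewrite sqr_sqrtr// sumr_ge0// => i _; exact: sqr_ge0.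
(* Write [(N + S) ^+ 2] as a sum over coordinates and compare termwise: the cross term is controlled
   by [N * |t_i|] and [t_i ^+ 2] by [|t_i| * S]. *)
rewrite sqrrD NE expr2 -mulr_natr {1}/S mulr_sumr mulr_suml {2}/S mulr_suml.
rewrite -!big_split/=; apply: ler_sum => i _; rewrite mxE sqrrD -mulr_natr.
have ht := tS i; have hy := yN i; have tn := normr_ge0 (t ord0 i).
have yt : y ord0 i * t ord0 i <= N * `|t ord0 i|.
  by rewrite (le_trans (ler_norm _))// normrM ler_wpM2r.
have tt : t ord0 i ^+ 2 <= `|t ord0 i| * S.
  by rewrite -real_normK ?num_real// expr2 ler_wpM2l.
by rewrite !lerD// ler_wpM2r.
Qed.
End ball_volume.

(** * Integrals under almost everywhere bounds *)

Section bounded_Rintegral.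
Context d (T : measurableType d) (R : realType).
Variable mu : {measure set T -> \bar R}.
Implicit Types (A C D : set T) (f : T -> R) (M : R).

(** Almost everywhere [g - f] equals its absolute value, whose integral is nonnegative. *)
Lemma ae_le_Rintegral A f g : measurable A ->
  mu.-integrable A (EFin \o f) -> mu.-integrable A (EFin \o g) ->
  (\forall x \ae mu, f x <= g x) ->
  \int[mu]_(x in A) f x <= \int[mu]_(x in A) g x.
Proof.
move=> mA intf intg fg; rewrite -subr_ge0 -RintegralB//.
have mgf : measurable_fun A (g \- f).
  by apply: measurable_funB; apply/measurable_EFinP; exact: (measurable_int mu).
rewrite [X in 0 <= X](_ : _ = \int[mu]_(x in A) `|g x - f x|).
  by apply: Rintegral_ge0 => x _.
congr fine; apply: ae_eq_integral => //.
- exact/measurable_EFinP.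
- by apply/measurable_EFinP; exact: measurableT_comp mgf.
- by apply: filterS fg => x fgx _; rewrite ger0_norm// subr_ge0.
Qed.

Lemma le_norm_Rintegral_ae A f M : measurable A -> (mu A < +oo)%E -> 0 <= M ->
  mu.-integrable A (EFin \o f) -> (\forall x \ae mu, `|f x| <= M) ->
  `|\int[mu]_(x in A) f x| <= M * fine (mu A).
Proof.
move=> mA Aoo M0 intf fM; apply: (le_trans (le_normr_Rintegral mA intf)).
have Afin : mu A \is a fin_num by rewrite ge0_fin_numE.
have -> : M * fine (mu A) = fine (\int[mu]_(x in A) M%:E)%E.
  by rewrite integral_cst// fineM.
apply: fine_le.
- by apply: integrable_fin_num => //; exact: (integrable_norm intf).
- by rewrite integral_cst// fin_numM.
apply: (@ae_ge0_le_integral _ _ _ mu A mA (fun x => `|f x|%:E) (fun=> M%:E)).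
- by move=> x _; rewrite lee_fin.
- by case/integrableP: (integrable_norm intf).
- by move=> x _; rewrite lee_fin.
- exact: measurable_cst.
- by apply: filterS fM => x /= fx _; rewrite lee_fin.
Qed.

(** The difference is the integral over [A \ D], which lies in [C \ D]. The bound depends on [C] and
    [D] only, so it serves for a ball and for its translate alike. *)
Lemma le_norm_Rintegral_diff A C D f M :
  measurable A -> measurable C -> measurable D -> D `<=` A -> A `<=` C ->
  (mu C < +oo)%E -> 0 <= M ->
  mu.-integrable C (EFin \o f) -> (\forall x \ae mu, `|f x| <= M) ->
  `|\int[mu]_(x in A) f x - \int[mu]_(x in D) f x| <=
    M * (fine (mu C) - fine (mu D)).
Proof.
move=> mA mC mD DA AC Coo M0 intf fM.
have mAD : measurable (A `\` D) by exact: measurableD.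
have ltoo B : measurable B -> B `<=` C -> (mu B < +oo)%E.
  by move=> mB BC; apply: le_lt_trans Coo; apply: le_measure; rewrite ?inE.
have fin B : measurable B -> B `<=` C -> mu B \is a fin_num.
  by move=> mB BC; rewrite ge0_fin_numE// ltoo.
have DC := subset_trans DA AC.
have ADC : A `\` D `<=` C by apply: subset_trans AC; exact: subDsetl.
have -> : \int[mu]_(x in A) f x =
    \int[mu]_(x in D) f x + \int[mu]_(x in A `\` D) f x.
  rewrite -Rintegral_setU//; first by rewrite setDUK.
  - by rewrite setDUK//; exact: integrableS intf.
  - by apply/disj_set2P; rewrite setDIK.
rewrite addrAC subrr add0r.
apply: (le_trans (le_norm_Rintegral_ae _ _ M0 _ fM)) => //.
- exact: ltoo.
- exact: integrableS intf.
rewrite ler_wpM2l// -fineB ?fin//; apply: fine_le; rewrite ?fin//.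
  by rewrite fin_numB ?fin.
rewrite -[in leRHS](setDUK DC) measureU//; [|exact: measurableD|by rewrite setDIK].
rewrite addeAC subee ?fin// add0e; apply: le_measure; rewrite ?inE//.
  exact: measurableD.
exact: setSD.
Qed.

End bounded_Rintegral.

(** * Averages over balls and their behaviour under translation *)

Section cesaro_average.
Context (R : realType) (n : nat).
Local Notation mu := (lebesgue_Rn R n).
Implicit Types (u v : Linfty mu) (r s M : R) (t : 'rV[R]_n).

Lemma measurable_Linfty u : measurable_fun setT (u : Rn R n -> R).
Proof. exact: measurable_funPT (Lrepr u). Qed.

(** Translation preserves [mu], so [mu] is its own pushforward under [phi]. The change of variables
    is made for nonnegative functions and applied to the positive and negative parts of [f]. *)
Lemma Rintegral_shift_fun t (B : set (Rn R n)) (f : Rn R n -> R) :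
  measurable B -> measurable_fun setT f ->
  \int[mu]_(y in B) shift_fun t f y =
  \int[mu]_(y in [set y : 'rV[R]_n | B (y + t)] : set (Rn R n)) f y.
Proof.
move=> mB mf; pose A : set (Rn R n) := [set y : 'rV[R]_n | B (y + t)].
pose phi : Rn R n -> Rn R n := fun y => (y : 'rV[R]_n) - t.
have mphi : measurable_fun setT phi.
  by move=> _ Y mY; rewrite setTI; exact: lebesgue_Rn_shift.
have BE : B = phi @^-1` A.
  by apply/seteqP; split => y; rewrite /A /phi/= subrK.
have mA : measurable A.
  have := lebesgue_Rn_shift (- t) mB.
  by rewrite /A; under eq_set do rewrite opprK.
rewrite -/A /Rintegral; congr fine; rewrite [in LHS]BE.
have shiftE (g : Rn R n -> \bar R) : measurable_fun setT g ->
    (forall y, 0 <= g y)%E ->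
    (\int[mu]_(y in phi @^-1` A) g (phi y) = \int[mu]_(y in A) g y)%E.
  move=> mg g0.
  rewrite -(@ge0_integral_pushforward _ _ _ _ _ phi mphi mu A g)//.
  - by apply: eq_measure_integral => X mX _; exact: (outer_lebesgue_shift X t).
  - exact: measurable_funTS.
have mEf : measurable_fun setT (EFin \o f) by exact/measurable_EFinP.
rewrite integralE [RHS]integralE; congr (_ - _)%E.
- rewrite -(shiftE _ (measurable_funepos mEf) (funepos_ge0 _)).
  by apply: eq_integral => y _; rewrite !funeposE.
- rewrite -(shiftE _ (measurable_funeneg mEf) (funeneg_ge0 _)).
  by apply: eq_integral => y _; rewrite !funenegE.
Qed.

Lemma le_norm_cesaro_fun u r M : 0 <= M -> (\forall x \ae mu, `|u x : R| <= M) ->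
  `|cesaro_fun (u : Rn R n -> R) r| <= M.
Proof.
move=> M0 uM; rewrite /cesaro_fun; case: ifPn => r0; last by rewrite normr0.
rewrite -/(ball_volume n r) normrM ger0_norm ?invr_ge0 ?ball_volume_ge0//.
have := le_norm_Rintegral_ae (measurable_eucl_ball r)
  (lebesgue_Rn_eucl_ball_lty n r) M0 (Linfty_integrable_eucl_ball u r) uM.
rewrite -/(ball_volume n r).
(* For a ball of volume 0 the convention [0^-1 = 0] makes the average 0. *)
have [->|V0] := eqVneq (ball_volume n r) 0; first by rewrite invr0 mul0r.
by rewrite ler_pdivrMl ?lt0r ?V0 ?ball_volume_ge0// mulrC.
Qed.

Lemma cesaro_fun_linear u v r (a : R) :
  cesaro_fun (fun y : Rn R n => a * (u y : R) + (v y : R)) r =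
  a * cesaro_fun (u : Rn R n -> R) r + cesaro_fun (v : Rn R n -> R) r.
Proof.
rewrite /cesaro_fun; case: ifPn => _; last by rewrite mulr0 addr0.
have mB := measurable_eucl_ball (n := n) r.
have iu := Linfty_integrable_eucl_ball u r.
have iv := Linfty_integrable_eucl_ball v r.
rewrite RintegralD//; first by rewrite RintegralZl// mulrDr mulrCA.
exact: (integrableZl mB a iu).
Qed.

Lemma le_cesaro_fun u v r : (\forall x \ae mu, (u x : R) <= (v x : R)) ->
  cesaro_fun (u : Rn R n -> R) r <= cesaro_fun (v : Rn R n -> R) r.
Proof.
move=> uv; rewrite /cesaro_fun; case: ifPn => // _.
rewrite ler_wpM2l ?invr_ge0 ?fine_ge0//.
apply: ae_le_Rintegral uv; first exact: measurable_eucl_ball.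
- exact: Linfty_integrable_eucl_ball.
- exact: Linfty_integrable_eucl_ball.
Qed.

(** The condition [S < r] makes the inner radius [r - S] positive, so that the scaling law applies
    to the inner ball. *)
Lemma le_norm_cesaro_fun_shiftB u t r M :
  0 <= M -> (\forall x \ae mu, `|u x : R| <= M) ->
  let S := \sum_i `|t ord0 i| in S < r ->
  `|cesaro_fun (shift_fun t (u : Rn R n -> R)) r -
    cesaro_fun (u : Rn R n -> R) r| <=
  2 * M * ((1 + S / r) ^+ n - (1 - S / r) ^+ n).
Proof.
move=> M0 uM S Sr.
have S0 : 0 <= S by apply: sumr_ge0 => i _; exact: normr_ge0.
have r0 : 0 < r := le_lt_trans S0 Sr.
rewrite /cesaro_fun r0 -mulrBr -/(ball_volume n r).
set V := ball_volume n r; set a := Rintegral _ _ _; set b := Rintegral _ _ _.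
(* By the scaling law, division by [V] cancels the volume of the unit ball and turns the radii
   [r + S] and [r - S] into [1 + S / r] and [1 - S / r]. *)
suff ab : `|a - b| <= 2 * M * (ball_volume n (r + S) - ball_volume n (r - S)).
  rewrite normrM ger0_norm ?invr_ge0 ?ball_volume_ge0//.
  have Vi0 : 0 <= V^-1 by rewrite invr_ge0 ball_volume_ge0.
  apply: (le_trans (ler_wpM2l Vi0 ab)).
  rewrite /V (ball_volumeE n r0) (ball_volumeE n (ltr_wpDr S0 r0)).
  rewrite (@ball_volumeE _ n (r - S)) ?subr_gt0// -mulrBl.
  have -> : 1 + S / r = (r + S) / r by rewrite mulrDl divff ?gt_eqF.
  have -> : 1 - S / r = (r - S) / r by rewrite mulrBl divff ?gt_eqF.
  rewrite !expr_div_n -mulrBl.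
  (* The volume of the unit ball need not be known to be positive: if it is 0
     then so is [V], and [0^-1 = 0] makes the left-hand side vanish. *)
  set V1 := ball_volume n 1; have [->|V1_neq0] := eqVneq V1 0.
    rewrite !mulr0; apply: mulr_ge0; first exact: mulr_ge0.
    apply: divr_ge0; last by rewrite exprn_ge0// ltW.
    have rS : r - S <= r + S by rewrite lerD2l (le_trans _ S0)// oppr_le0.
    have rS0 : 0 <= r - S by rewrite subr_ge0 ltW.
    by rewrite subr_ge0 lerXn2r// nnegrE// (le_trans rS0).
  rewrite le_eqVlt; apply/orP; left; apply/eqP; field.
  by rewrite V1_neq0 gt_eqF// exprn_gt0.
have mB s := measurable_eucl_ball (n := n) s.
set C := eucl_ball n (r + S); set D := eucl_ball n (r - S).
set A : set (Rn R n) := [set y : 'rV[R]_n | eucl_ball n r (y + t)].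
have mA : measurable A.
  have := lebesgue_Rn_shift (- t) (mB r).
  by rewrite /A; under eq_set do rewrite opprK.
have AC : A `<=` C.
  move=> y /(eucl_ball_translate (- t)); rewrite addrK.
  by under eq_bigr do rewrite mxE normrN.
have DA : D `<=` A.
  by move=> y /(eucl_ball_translate t); rewrite subrK.
have aE : a = \int[mu]_(y in A) (u y : R).
  exact (Rintegral_shift_fun t (mB r) (measurable_Linfty u)).
(* The integrals over the translated ball [A] and over the ball itself are both compared with the
   one over [D]; the two comparisons give the factor 2. *)
have key (E : set (Rn R n)) mE DE EC := @le_norm_Rintegral_diff _ _ _ mu E C D
  (u : Rn R n -> R) M mE (mB (r + S)) (mB (r - S)) DE EC
  (lebesgue_Rn_eucl_ball_lty n (r + S)) M0
  (Linfty_integrable_eucl_ball u (r + S)) uM.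
have := key A mA DA AC; have := key _ (mB r).
rewrite -aE -/b -/(ball_volume n (r + S)) -/(ball_volume n (r - S)).
set W := M * _ => bW aW.
have -> : a - b = (a - \int[mu]_(y in D) (u y : R)) - (b - \int[mu]_(y in D) (u y : R)).
  by rewrite opprB addrA subrK.
rewrite -mulrA [2 * _]mulrDl mul1r (le_trans (ler_normB _ _))// lerD//.
by apply: bW; apply: subset_eucl_ball; rewrite ?lerBlDr lerDl.
Qed.

End cesaro_average.

(** * The limit of the averages along the ultrafilter *)

Section Blim.
Context (R : realType) (n : nat) (U : set_system R).
Hypothesis hU : right_lebesgue_ultrafilter U.
Local Notation mu := (lebesgue_Rn R n).
Implicit Types (u v : Linfty mu).

Lemma right_lebesgue_ultrafilter_proper : ProperFilter U.
Proof. by case: hU => -[]. Qed.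
Let UPF := right_lebesgue_ultrafilter_proper.
#[local] Existing Instance UPF.

(** [Blim] is defined through a chosen representative of the class of averages. It agrees with
    [cesaro_fun] off a null set, whose complement is in [U], so limits can be computed on the actual
    averages. *)
Lemma Blim_cvg u : cesaro_fun (u : Rn R n -> R) @ U --> Blim U u.
Proof.
have [_ nullU _] := hU.
have := nullU _ (LclassE (Lfun_Sub (leey 1%E) (cesaro_fun_Lfun u))).
rewrite setCK => ae_u X /(ulim_cvg (v := Defs.cesaro u) hU).
by apply: (@filterS2 R U _ _ _ _ _ ae_u) => x /= /(_ I) /= <-.
Qed.

Arguments Blim_cvg : clear implicits.

Lemma Blim_unique u (l : R) :
  cesaro_fun (u : Rn R n -> R) @ U --> l -> Blim U u = l.
Proof. exact: cvg_unique (@norm_hausdorff R R) _ _ _ _ (Blim_cvg u). Qed.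

Lemma Blim_linear : scalar (Blim U : Linfty mu -> R).
Proof.
move=> a u v.
(* The representative of [a *: u + v] is the pointwise combination only almost everywhere, but
   averages do not see the difference. *)
have auv : a *: u + v = (fun y : Rn R n => a * (u y : R) + (v y : R)) %[ae mu].
  rewrite -[in a *: u](LreprK u) -[in _ + v](LreprK v) -LclassZ -LclassD.
  exact: LclassE.
have mauv : measurable_fun setT (fun y : Rn R n => a * (u y : R) + (v y : R)).
  apply: measurable_funD; last exact: measurable_Linfty.
  by apply: measurable_funM; [exact: measurable_cst|exact: measurable_Linfty].
apply: Blim_unique.
rewrite (cesaro_fun_ae_eq (measurable_Linfty _) mauv auv).
rewrite (funext (cesaro_fun_linear u v ^~ a)).
exact: cvgD (cvgMl_tmp (Blim_cvg u)) (Blim_cvg v).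
Qed.

Lemma le_Blim u v : (\forall x \ae mu, (u x : R) <= (v x : R)) ->
  Blim U u <= Blim U v.
Proof.
move=> uv; apply: ler_cvg_to (Blim_cvg u) (Blim_cvg v) _.
by apply: nearW => x; exact: le_cesaro_fun.
Qed.

Lemma Linfty_norm_ae u : \forall x \ae mu, `|u x : R| <= `|u|.
Proof.
(* The norm is the essential supremum only if the space has positive measure; otherwise every
   property holds almost everywhere. *)
have [mu0|mu0] := ltP 0%E (mu setT); last first.
  exists setT; split; [exact: measurableT| |by []].
  by apply/eqP; rewrite eq_le mu0 measure_ge0.
have := Lfunction_finite _ (Lrepr u).
rewrite [X in \forall x \ae mu, _ <= X](_ : _ =
  fine ('N[mu]_+oo[EFin \o (u : Rn R n -> R)])%E)//.
rewrite /finite_norm unlock /Lnorm mu0 => supoo.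
apply: filterS (ess_sup_ge mu (abse \o (EFin \o Lrepr u))) => x /= ux.
rewrite -lee_fin fineK//= ge0_fin_numE//.
exact: le_trans ux.
Qed.

Lemma le_norm_Blim u : `|Blim U u| <= `|u|.
Proof.
have ub := fun r => le_norm_cesaro_fun r (normr_ge0 u) (Linfty_norm_ae u).
apply: ler_cvg_to (cvg_norm (Blim_cvg u)) (cvg_cst _) _.
exact: nearW.
Qed.

Lemma Blim_continuous : continuous (Blim U : Linfty mu -> R).
Proof.
have Blim_sub u v : Blim U (u - v) = Blim U u - Blim U v.
  by rewrite -scaleN1r addrC Blim_linear mulN1r addrC.
(* By linearity and [le_norm_Blim] the functional is 1-Lipschitz, so the same radius [e] works. *)
move=> u X /nbhs_ballP[e /= e0 eX]; apply/nbhs_ballP; exists e => //= v.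
rewrite -ball_normE /= => uv; apply: eX.
rewrite -ball_normE /= -Blim_sub.
exact: le_lt_trans (le_norm_Blim _) uv.
Qed.

Lemma cvg_inv_right_lebesgue_ultrafilter : (fun r : R => r^-1) @ U --> (0 : R).
Proof.
have [_ _ Uoo] := hU; apply/cvgrPdist_lt => e e0.
apply: (@filterS R U _ _ _ _ (Uoo e^-1)) => r /=.
rewrite in_itv/= andbT => er.
have r0 : 0 < r by rewrite (lt_trans _ er)// invr_gt0.
by rewrite sub0r normrN gtr0_norm ?invr_gt0// invf_plt.
Qed.

Lemma Blim_translate u (t : 'rV[R]_n) : Blim U (translate t u) = Blim U u.
Proof.
have [_ _ Uoo] := hU.
have M0 := normr_ge0 u; have uM := Linfty_norm_ae u.
set S := \sum_i `|t ord0 i|.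
(* Since [S / r] tends to 0, both powers tend to 1 and their difference to 0. *)
have bound0 : (fun r : R => 2 * `|u| * ((1 + S / r) ^+ n - (1 - S / r) ^+ n))
    @ U --> (0 : R).
  have Sr : (fun r : R => S / r) @ U --> (0 : R).
    rewrite -[X in _ --> X](mulr0 S).
    exact: cvgMl_tmp cvg_inv_right_lebesgue_ultrafilter.
  have power1 (s : R -> R) : s @ U --> (0 : R) ->
      (fun r => (1 + s r) ^+ n) @ U --> (1 : R).
    move=> s0; suff: (fun r => (1 + s r) ^+ n) @ U --> ((1 + 0) ^+ n : R).
      by rewrite addr0 expr1n.
    apply: (@continuous_cvg _ _ _ U _ (fun r => 1 + s r) (fun x => x ^+ n)).
      exact: exprn_continuous.
    by apply: cvgD => //; exact: cvg_cst.
  rewrite -[X in _ --> X](mulr0 (2 * `|u|)); apply: cvgMl_tmp.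
  rewrite -[X in _ --> X](subrr (1 : R)); apply: cvgB; first exact: power1.
  by apply: power1; rewrite -[X in _ --> X]oppr0; exact: cvgN.
have tE : translate t u = shift_fun t (u : Rn R n -> R) %[ae mu].
  exact: LclassE.
have mtu := measurable_shift_fun t (measurable_Linfty u).
suff diff0 : (fun r => cesaro_fun (translate t u : Rn R n -> R) r -
    cesaro_fun (u : Rn R n -> R) r) @ U --> (0 : R).
  apply/eqP; rewrite -subr_eq0; apply/eqP.
  apply: (cvg_unique (@norm_hausdorff R R) _ diff0).
  exact: cvgB (Blim_cvg _) (Blim_cvg _).
rewrite (cesaro_fun_ae_eq (measurable_Linfty _) mtu tE).
apply/norm_cvg0P; apply: squeeze_cvgr (cvg_cst 0) bound0.
(* The estimate requires [S < r], which holds on a half-line belonging to [U]. *)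
apply: (@filterS R U _ _ _ _ (Uoo S)) => r /=.
rewrite in_itv/= andbT => Sr; rewrite normr_ge0/=.
exact: le_norm_cesaro_fun_shiftB.
Qed.

End Blim.

Theorem mainTheorem7 (R : realType) (n : nat) (n_ge1 : (1 <= n)%N)
    (U : set_system R) (hU : right_lebesgue_ultrafilter U) :
  [/\ scalar (Blim U : Linfty (lebesgue_Rn R n) -> R),
      forall u v : Linfty (lebesgue_Rn R n),
        (\forall x \ae lebesgue_Rn R n, (u x : R) <= (v x : R)) -> Blim U u <= Blim U v,
      continuous (Blim U : Linfty (lebesgue_Rn R n) -> R) &
      forall (u : Linfty (lebesgue_Rn R n)) (t : 'rV[R]_n),
        Blim U (translate t u) = Blim U u].
Proof.
split.
- exact: Blim_linear.
- by move=> u v; exact: le_Blim.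
- exact: Blim_continuous.
- by move=> u t; exact: Blim_translate.
Qed.
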